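(* If $\beta$ is an ordinal, then there exist an ordinal $\alpha$ and a natural number $n$ such that $\bigcup\alpha=\alpha$ and $\beta=\alpha+n$.
   Context: We work in the following first-order theory with one binary relation $\in$; all objects are called sets. Definitions: $s$ is an individual if $s\in s$. $s=t$ means $\forall u(u\in s\leftrightarrow u\in t)$. Axioms: (equality) $\forall s\forall t(s=t\rightarrow\forall u(s\in u\leftrightarrow t\in u))$; (individuals) $\forall s(s\in s\rightarrow\forall u(u\in s\rightarrow u=s))$; (pairs) $\forall s\forall t\exists v\forall u(u\in v\leftrightarrow(u=s\vee u=t))$, $v$ denoted $\{s,t\}$, and $\{s\}=\{s,s\}$; (regularity) $\forall s\exists v\,[(v\in s\wedge v\in v\wedge\forall u(u\in s\rightarrow u\in u))\vee(v\in s\wedge v\notin v\wedge\forall u(u\in v\wedge u\notin u\rightarrow u\notin s))]$; (union) $\forall s\exists v\forall u(u\in v\leftrightarrow\exists w(w\in s\wedge u\in w))$, $v$ denoted $\bigcup s$, and $s\cup t=\bigcup\{s,t\}$; (power) $\forall s\exists v\forall u(u\in v\leftrightarrow\forall w(w\in u\rightarrow w\in s))$; (separation) for every formula $\Phi(u)$ with $u$ free: $\forall s(\exists u(u\in s\wedge\Phi(u))\rightarrow\exists v\forall u(u\in v\leftrightarrow u\in s\wedge\Phi(u)))$. (In particular every set has a member; there is no empty set.) $s\subseteq t$ means $\forall u(u\in s\rightarrow u\in t)$. $s$ is transitive if $\forall u(u\in s\rightarrow u\subseteq s)$; in the phrase ''transitive set'' the set is not an individual, whereas ''transitive members'' may be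 individuals. A pair of different individuals $o\neq e$ is fixed and $0=\{o,e\}$. $s$ is a natural number if $s$ is a transitive set with transitive members and $s\notin 0\wedge\forall u(u\in s\cup\{s\}\rightarrow u\in 0\cup\{0\}\vee\bigcup u\in u)$. The first natural number is $0$, and $n+1=n\cup\{n\}$. $\beta$ is an ordinal if $\beta$ is a transitive set with transitive members and $\beta\notin 0\wedge\forall u(u\in\beta\wedge u\in u\rightarrow u\in 0)$. An ordinal $\alpha$ is called a first number if $\bigcup\alpha=\alpha$. For an ordinal $\beta$ and natural numbers $n$: $\beta+0=\beta$, $\beta+(n+1)=(\beta+n)\cup\{\beta+n\}$. *)

(* Defs.v *)
From Stdlib Require Import ClassicalEpsilon.

Set Implicit Arguments.
Unset Strict Implicit.

Record structure : Type := {
  dom :> Type;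
  mem : dom -> dom -> Prop
}.

Declare Scope ind_scope.
Delimit Scope ind_scope with ind.
Open Scope ind_scope.

Notation "s \in t" := (mem s t) (at level 70, no associativity) : ind_scope.
Notation "s \notin t" := (~ mem s t) (at level 70, no associativity) : ind_scope.

(* Equality is a defined notion, not a primitive one: [dom] may contain distinct
   elements that are coextensional. *)
Definition eqs (M : structure) (s t : M) : Prop :=
  forall u : M, u \in s <-> u \in t.
Notation "s == t" := (eqs s t) (at level 70, no associativity) : ind_scope.

Definition individual (M : structure) (s : M) : Prop := s \in s.

(* First-order formulas in the language {\in}, with de Bruijn indices for
   variables.  They are needed because separation is a schema over formulas:
   quantifying over all predicates [M -> Prop] would be a stronger,
   second-order axiom. *)
Inductive formula : Type :=
| fMem : nat -> nat -> formula
| fNot : formula -> formula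
| fAnd : formula -> formula -> formula
| fOr : formula -> formula -> formula
| fImp : formula -> formula -> formula
| fAll : formula -> formula
| fEx : formula -> formula.

Definition scons (M : Type) (a : M) (rho : nat -> M) (i : nat) : M :=
  match i with
  | O => a
  | S j => rho j
  end.

Fixpoint sat (M : structure) (rho : nat -> M) (phi : formula) : Prop :=
  match phi with
  | fMem i j => rho i \in rho j
  | fNot p => ~ sat rho p
  | fAnd p q => sat rho p /\ sat rho q
  | fOr p q => sat rho p \/ sat rho q
  | fImp p q => sat rho p -> sat rho q
  | fAll p => forall a : M, sat (scons a rho) p
  | fEx p => exists a : M, sat (scons a rho) p
  end.

(* In the separation schema variable 0 is the distinguished variable u, and
   [rho] supplies the values of the other free variables (parameters). *)
Record model : Type := {
  carrier :> structure;
  ax_equality : forall s t : carrier,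
    s == t -> forall u : carrier, s \in u <-> t \in u;
  ax_individuals : forall s : carrier,
    s \in s -> forall u : carrier, u \in s -> u == s;
  ax_pairs : forall s t : carrier,
    exists v : carrier, forall u : carrier, u \in v <-> (u == s \/ u == t);
  ax_regularity : forall s : carrier, exists v : carrier,
    (v \in s /\ v \in v /\ forall u : carrier, u \in s -> u \in u) \/
    (v \in s /\ v \notin v /\
       forall u : carrier, u \in v /\ u \notin u -> u \notin s);
  ax_union : forall s : carrier, exists v : carrier, forall u : carrier,
    u \in v <-> exists w : carrier, w \in s /\ u \in w;
  ax_power : forall s : carrier, exists v : carrier, forall u : carrier,
    u \in v <-> forall w : carrier, w \in u -> w \in s;
  ax_separation : forall (phi : formula) (rho : nat -> carrier) (s : carrier),
    (exists u : carrier, u \in s /\ sat (scons u rho) phi) ->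
    exists v : carrier, forall u : carrier,
      u \in v <-> (u \in s /\ sat (scons u rho) phi)
}.

(* The sets named by terms are determined only up to [==]; a representative is
   chosen.  By [ax_equality] the choice is immaterial. *)
Definition pair (M : model) (s t : M) : M :=
  proj1_sig (constructive_indefinite_description _ (ax_pairs s t)).

Definition bigcup (M : model) (s : M) : M :=
  proj1_sig (constructive_indefinite_description _ (ax_union s)).

Lemma pairP (M : model) (s t u : M) : u \in pair s t <-> (u == s \/ u == t).
Proof.
exact (proj2_sig (constructive_indefinite_description _ (ax_pairs s t)) u).
Qed.

Lemma bigcupP (M : model) (s u : M) :
  u \in bigcup s <-> exists w : M, w \in s /\ u \in w.
Proof.
exact (proj2_sig (constructive_indefinite_description _ (ax_union s)) u).
Qed.

Definition sing (M : model) (s : M) : M := pair s s.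
Definition cup (M : model) (s t : M) : M := bigcup (pair s t).
Definition succ (M : model) (s : M) : M := cup s (sing s).

Definition subset (M : structure) (s t : M) : Prop :=
  forall u : M, u \in s -> u \in t.

Definition transitive (M : structure) (s : M) : Prop :=
  forall u : M, u \in s -> subset u s.

(* A "transitive set" is not an individual, but its transitive members may be. *)
Definition transitive_set_tm (M : structure) (s : M) : Prop :=
  ~ individual s /\ transitive s /\ forall u : M, u \in s -> transitive u.

(* In what follows [o] and [e] are the two fixed different individuals, and
   0 = {o, e}. *)
Definition zero (M : model) (o e : M) : M := pair o e.

Definition natural (M : model) (o e s : M) : Prop :=
  transitive_set_tm s /\
  s \notin zero o e /\
  forall u : M, u \in cup s (sing s) ->
    u \in cup (zero o e) (sing (zero o e)) \/ bigcup u \in u.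

Definition ordinal (M : model) (o e b : M) : Prop :=
  transitive_set_tm b /\
  b \notin zero o e /\
  forall u : M, u \in b /\ u \in u -> u \in zero o e.

(* Kuratowski pair {{s}, {s, t}}. *)
Definition opair (M : model) (s t : M) : M := pair (sing s) (pair s t).

(* [f] is a function, as a set of ordered pairs, whose domain consists of the
   natural numbers 0, ..., n (the members of n + 1 other than o and e), with
   f(0) = b and f(k + 1) = f(k) \cup {f(k)} for k < n. *)
Definition plus_recursion (M : model) (o e b n f : M) : Prop :=
  (forall p : M, p \in f -> exists k x : M,
     natural o e k /\ k \in succ n /\ p == opair k x) /\
  (forall k : M, natural o e k -> k \in succ n ->
     exists x : M, opair k x \in f /\
       forall y : M, opair k y \in f -> y == x) /\
  opair (zero o e) b \in f /\
  (forall k x : M, natural o e k -> k \in n -> opair k x \in f ->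
     opair (succ k) (succ x) \in f).

(* c = b + n.  The natural numbers of a model may be nonstandard, so the
   recursion b + 0 = b, b + (n + 1) = (b + n) \cup {b + n} has to be carried
   out inside the model rather than along [nat]. *)
Definition is_plus (M : model) (o e b n c : M) : Prop :=
  exists f : M, plus_recursion o e b n f /\ opair n c \in f.

(* Main.v *)
From Stdlib Require Import Setoid Morphisms Classical.
Require Import Defs.

Set Implicit Arguments.
Unset Strict Implicit.

(** By [\in]-induction on beta, carried out inside the model.  Either
    [bigcup beta == beta], and then [beta = beta + 0], or some [d] in beta is
    not in [bigcup beta]; since the members of an ordinal are comparable,
    [beta = d + 1], and a recursion witnessing [d = alpha + n] extends by the
    pair [(n + 1, beta)] to one witnessing [beta = alpha + (n + 1)].  There is
    no empty set to start from: instead, a set that is not an individual and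
    has all its members in [0 = {o, e}] is equal to [0], so regularity puts
    [o] and [e] in every ordinal.  The induction uses separation for
    "decomposable as alpha + n", so this property must be shown definable. *)

(** * Predicates and terms definable by first-order formulas *)

Section Definability.
Variable M : model.

Fixpoint rename (xi : nat -> nat) (phi : formula) : formula :=
  let up i := match i with O => O | S j => S (xi j) end in
  match phi with
  | fMem i j => fMem (xi i) (xi j)
  | fNot p => fNot (rename xi p)
  | fAnd p q => fAnd (rename xi p) (rename xi q)
  | fOr p q => fOr (rename xi p) (rename xi q)
  | fImp p q => fImp (rename xi p) (rename xi q)
  | fAll p => fAll (rename up p)
  | fEx p => fEx (rename up p)
  end.

Lemma sat_rename (phi : formula) : forall (xi : nat -> nat) (rho rho' : nat -> M),
  (forall i, rho (xi i) = rho' i) -> (sat rho (rename xi phi) <-> sat rho' phi).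
Proof.
  assert (scons_up : forall (xi : nat -> nat) (rho rho' : nat -> M) (a : M),
    (forall i, rho (xi i) = rho' i) ->
    forall i, scons a rho (match i with O => O | S j => S (xi j) end)
              = scons a rho' i).
  { intros xi rho rho' a H [|i]; simpl; auto. }
  induction phi as [i j|p IHp|p IHp q IHq|p IHp q IHq|p IHp q IHq|p IHp|p IHp];
    intros xi rho rho' H; simpl.
  - rewrite !H; tauto.
  - rewrite (IHp _ _ _ H); tauto.
  - rewrite (IHp _ _ _ H), (IHq _ _ _ H); tauto.
  - rewrite (IHp _ _ _ H), (IHq _ _ _ H); tauto.
  - rewrite (IHp _ _ _ H), (IHq _ _ _ H); tauto.
  - split; intros H' a; specialize (H' a);
      apply (IHp _ _ _ (scons_up xi rho rho' a H)) in H'; exact H'.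
  - split; intros [a H']; exists a;
      apply (IHp _ _ _ (scons_up xi rho rho' a H)) in H'; exact H'.
Qed.

Definition definable (P : (nat -> M) -> Prop) : Prop :=
  exists phi, forall rho, sat rho phi <-> P rho.

Definition definable_term (t : (nat -> M) -> M) : Prop :=
  definable (fun rho => rho 0 \in t (fun i => rho (S i))).

Lemma definable_rename (P : (nat -> M) -> Prop) (xi : nat -> nat) :
  definable P -> definable (fun rho => P (fun i => rho (xi i))).
Proof.
  intros [phi H]. exists (rename xi phi). intros rho.
  rewrite <- H. apply sat_rename; reflexivity.
Qed.

Lemma definable_ext (P Q : (nat -> M) -> Prop) :
  (forall rho, P rho <-> Q rho) -> definable P -> definable Q.
Proof. intros HPQ [phi H]; exists phi; intros rho; now rewrite H. Qed.

Lemma definable_var_mem (i j : nat) : definable (fun rho => rho i \in rho j).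
Proof. now exists (fMem i j). Qed.

Lemma definable_not (P : (nat -> M) -> Prop) :
  definable P -> definable (fun rho => ~ P rho).
Proof. intros [p Hp]; exists (fNot p); intros rho; simpl; now rewrite Hp. Qed.

Lemma definable_and (P Q : (nat -> M) -> Prop) :
  definable P -> definable Q -> definable (fun rho => P rho /\ Q rho).
Proof.
  intros [p Hp] [q Hq]; exists (fAnd p q); intros rho; simpl; now rewrite Hp, Hq.
Qed.

Lemma definable_or (P Q : (nat -> M) -> Prop) :
  definable P -> definable Q -> definable (fun rho => P rho \/ Q rho).
Proof.
  intros [p Hp] [q Hq]; exists (fOr p q); intros rho; simpl; now rewrite Hp, Hq.
Qed.

Lemma definable_imp (P Q : (nat -> M) -> Prop) :
  definable P -> definable Q -> definable (fun rho => P rho -> Q rho).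
Proof.
  intros [p Hp] [q Hq]; exists (fImp p q); intros rho; simpl; now rewrite Hp, Hq.
Qed.

(** The quantified element becomes variable 0 of [scons a rho], whose shift is [rho] again by
    conversion. *)
Lemma definable_forall (P : (nat -> M) -> M -> Prop) :
  definable (fun rho => P (fun i => rho (S i)) (rho 0)) ->
  definable (fun rho => forall a, P rho a).
Proof.
  intros [p Hp]; exists (fAll p); intros rho; simpl.
  split; intros H a; specialize (H a); now apply Hp in H || apply Hp.
Qed.

Lemma definable_exists (P : (nat -> M) -> M -> Prop) :
  definable (fun rho => P (fun i => rho (S i)) (rho 0)) ->
  definable (fun rho => exists a, P rho a).
Proof.
  intros [p Hp]; exists (fEx p); intros rho; simpl.
  split; intros [a H]; exists a; now apply Hp in H || apply Hp.
Qed.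

Lemma definable_eqs (s t : (nat -> M) -> M) :
  definable_term s -> definable_term t -> definable (fun rho => s rho == t rho).
Proof.
  intros Hs Ht.
  apply (@definable_forall (fun rho a => a \in s rho <-> a \in t rho)).
  apply definable_and; apply definable_imp; assumption.
Qed.

Lemma definable_term_var (i : nat) : definable_term (fun rho => rho i).
Proof. apply definable_var_mem. Qed.

Lemma definable_term_weaken (t : (nat -> M) -> M) :
  definable_term t -> definable_term (fun rho => t (fun i => rho (S i))).
Proof.
  (* The renaming keeps the candidate member at 0 and skips index 1, the newly bound variable. *)
  apply (@definable_rename (fun rho => rho 0 \in t (fun i => rho (S i)))
           (fun i => match i with O => O | S j => S (S j) end)).
Qed.

(** Definability of [s] only controls what belongs to [s]; to place [s] on the left of membership,
    it is replaced by a coextensional [w], which the equality axiom permits. *)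
Lemma definable_mem (s t : (nat -> M) -> M) :
  definable_term s -> definable_term t -> definable (fun rho => s rho \in t rho).
Proof.
  intros Hs Ht.
  apply (@definable_ext (fun rho => exists w, w == s rho /\ w \in t rho)).
  { intros rho; split.
    - intros [w [Hw Hw']]; now apply (ax_equality Hw).
    - intros H; exists (s rho); now split. }
  apply (@definable_exists (fun rho w => w == s rho /\ w \in t rho)).
  apply definable_and; [|exact Ht].
  apply definable_eqs.
  - apply definable_term_var.
  - now apply definable_term_weaken.
Qed.

Lemma definable_term_pair (s t : (nat -> M) -> M) :
  definable_term s -> definable_term t ->
  definable_term (fun rho => pair (s rho) (t rho)).
Proof.
  intros Hs Ht.
  apply (@definable_ext (fun rho => rho 0 == s (fun i => rho (S i)) \/
                                    rho 0 == t (fun i => rho (S i)))).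
  { intros rho; now rewrite pairP. }
  apply definable_or; apply definable_eqs;
    auto using definable_term_var, definable_term_weaken.
Qed.

Lemma definable_term_bigcup (s : (nat -> M) -> M) :
  definable_term s -> definable_term (fun rho => bigcup (s rho)).
Proof.
  intros Hs.
  apply (@definable_ext (fun rho => exists w, w \in s (fun i => rho (S i)) /\
                                              rho 0 \in w)).
  { intros rho; now rewrite bigcupP. }
  apply (@definable_exists (fun rho w => w \in s (fun i => rho (S i)) /\ rho 0 \in w)).
  apply definable_and; [|apply definable_var_mem].
  now apply definable_term_weaken.
Qed.

End Definability.

(** Notions are unfolded down to pairs, unions, [\in] and [==], then the goal is decomposed by its
    shape. Implication comes before the universal quantifier because both are products. *)
Ltac definability :=
  cbv beta delta [natural ordinal transitive_set_tm transitive subset individual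
                  is_plus plus_recursion opair succ cup sing zero];
  repeat
  lazymatch goal with
  | |- definable (fun rho => _ == _) => apply definable_eqs
  | |- definable (fun rho => _ \in _) => apply definable_mem
  | |- definable (fun rho => ~ _) => apply definable_not
  | |- definable (fun rho => _ /\ _) => apply definable_and
  | |- definable (fun rho => _ \/ _) => apply definable_or
  | |- definable (fun rho => @?P rho -> @?Q rho) => apply (@definable_imp _ P Q)
  | |- definable (fun rho => forall a, @?P rho a) =>
      apply (@definable_forall _ P); cbv beta
  | |- definable (fun rho => exists a, @?P rho a) =>
      apply (@definable_exists _ P); cbv beta
  | |- definable_term (fun rho => pair _ _) => apply definable_term_pair
  | |- definable_term (fun rho => bigcup _) => apply definable_term_bigcup
  | |- definable_term (fun rho => rho _) => apply definable_term_var
  end.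

(** * Coextensionality as a congruence, for rewriting *)

#[local] Instance eqs_equivalence (M : structure) : Equivalence (@eqs M).
Proof.
  split.
  - intros s u; tauto.
  - intros s t H u; now rewrite (H u).
  - intros s t r H H' u; now rewrite (H u).
Qed.

#[local] Instance mem_proper (M : model) :
  Proper (@eqs M ==> @eqs M ==> iff) (@mem M).
Proof. intros s s' Hs t t' Ht. now rewrite (ax_equality Hs t). Qed.

#[local] Instance pair_proper (M : model) :
  Proper (@eqs M ==> @eqs M ==> @eqs M) (@pair M).
Proof. intros s s' Hs t t' Ht u. rewrite !pairP. now rewrite Hs, Ht. Qed.

#[local] Instance bigcup_proper (M : model) :
  Proper (@eqs M ==> @eqs M) (@bigcup M).
Proof.
  intros s s' Hs u. rewrite !bigcupP.
  split; intros [w [H H']]; exists w; split; trivial; now apply Hs.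
Qed.

#[local] Instance succ_proper (M : model) :
  Proper (@eqs M ==> @eqs M) (@succ M).
Proof. intros s s' Hs. unfold succ, cup, sing. now rewrite Hs. Qed.

#[local] Instance opair_proper (M : model) :
  Proper (@eqs M ==> @eqs M ==> @eqs M) (@opair M).
Proof. intros s s' Hs t t' Ht. unfold opair, sing. now rewrite Hs, Ht. Qed.

(** * Singletons, successors and ordered pairs *)

Section Sets.
Variable M : model.
Implicit Types s t u v w x y : M.

Lemma singP s u : u \in sing s <-> u == s.
Proof. unfold sing; rewrite pairP; tauto. Qed.

Lemma cupP s t u : u \in cup s t <-> u \in s \/ u \in t.
Proof.
  unfold cup; rewrite bigcupP; split.
  - intros [w [Hw Hu]]. apply pairP in Hw. destruct Hw as [Hw|Hw];
      rewrite Hw in Hu; auto.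
  - intros [H|H]; [exists s|exists t]; (split; [apply pairP|assumption]).
    + now left.
    + now right.
Qed.

Lemma succP s u : u \in succ s <-> u \in s \/ u == s.
Proof. unfold succ; now rewrite cupP, singP. Qed.

Lemma mem_succ s : s \in succ s.
Proof. apply succP; now right. Qed.

Lemma sing_inj s t : sing s == sing t -> s == t.
Proof. intros H; apply singP; rewrite <- H; now apply singP. Qed.

Lemma pair_sing s t x : pair s t == sing x -> s == x /\ t == x.
Proof.
  intros H; split; apply singP; rewrite <- H; apply pairP; [now left|now right].
Qed.

Lemma opair_inj s t s' t' : opair s t == opair s' t' -> s == s' /\ t == t'.
Proof.
  unfold opair; intros H.
  assert (Hs : s == s').
  { assert (A : sing s \in pair (sing s') (pair s' t')).
    { rewrite <- H; apply pairP; now left. }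
    apply pairP in A; destruct A as [A|A].
    - now apply sing_inj.
    - symmetry in A; apply pair_sing in A; now symmetry. }
  split; [exact Hs|].
  assert (A : pair s t \in pair (sing s') (pair s' t')).
  { rewrite <- H; apply pairP; now right. }
  assert (B : pair s' t' \in pair (sing s) (pair s t)).
  { rewrite H; apply pairP; now right. }
  apply pairP in A, B.
  assert (C : t \in pair s t) by (apply pairP; now right).
  assert (D : t' \in pair s' t') by (apply pairP; now right).
  (* Either [t == t'] is read off directly, or [t == s'] and [t' == s], and [Hs] joins the two. *)
  destruct A as [A|A]; [|rewrite A in C; apply pairP in C; destruct C as [C|C];
    [|exact C]]; destruct B as [B|B].
  - apply pair_sing in A, B. rewrite (proj2 A), (proj2 B). now symmetry.
  - rewrite B in D; apply pairP in D; destruct D as [D|D]; [|now symmetry].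
    apply pair_sing in A. now rewrite (proj2 A), D.
  - apply pair_sing in B. now rewrite C, (proj2 B), Hs.
  - rewrite B in D; apply pairP in D; destruct D as [D|D]; [|now symmetry].
    now rewrite C, D, Hs.
Qed.

(** Both [succ s \in s], by transitivity, and [succ s == s] would turn [s \in succ s] into
    [s \in s]. *)
Lemma succ_not_individual s :
  transitive s -> s \notin s -> succ s \notin succ s.
Proof.
  intros Ht Hs H; apply succP in H; destruct H as [H|H].
  - exact (Hs (Ht _ H _ (mem_succ s))).
  - apply Hs. pose proof (mem_succ s) as H'. now rewrite H in H'.
Qed.

Lemma bigcup_succ s : transitive s -> bigcup (succ s) == s.
Proof.
  intros Ht u; rewrite bigcupP; split.
  - intros [w [Hw Hu]]; apply succP in Hw; destruct Hw as [Hw|Hw].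
    + exact (Ht _ Hw _ Hu).
    + now rewrite <- Hw.
  - intros Hu; exists s; split; [apply mem_succ|exact Hu].
Qed.

End Sets.

(** * Ordinals: individual members, induction and comparability *)

Section Ordinals.
Variables (M : model) (o e : M).
Hypotheses (ho : individual o) (he : individual e) (hoe : ~ o == e).
Implicit Types a b s t u v w x y n f : M.

Lemma mem_zero u : u \in zero o e <-> u == o \/ u == e.
Proof. apply pairP. Qed.

Lemma zero_individual u : u \in zero o e -> u \in u.
Proof. rewrite mem_zero; intros [H|H]; rewrite H; assumption. Qed.

(** Regularity gives [s] a member. Were all members equal to one individual [a], then [s] would be
    coextensional with [a], whose only member is itself, and so be an individual. Hence both [o] and
    [e] occur. *)
Lemma eq_zero s : s \notin s -> subset s (zero o e) -> s == zero o e.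
Proof.
  intros Hs Hsub.
  assert (Hx : exists x, x \in s).
  { destruct (ax_regularity s) as [v [[H _]|[H _]]]; now exists v. }
  assert (all_eq : forall a, individual a -> ~ (forall u, u \in s -> u == a)).
  { intros a Ha H. apply Hs. destruct Hx as [x Hx].
    assert (E : s == a).
    { intros u; split; intros Hu.
      - rewrite (H u Hu); exact Ha.
      - rewrite (ax_individuals Ha Hu), <- (H x Hx); exact Hx. }
    rewrite E; exact Ha. }
  assert (Hos : o \in s).
  { apply NNPP; intros N. apply (all_eq e he); intros u Hu.
    destruct (proj1 (mem_zero u) (Hsub u Hu)) as [E|E]; [|exact E].
    rewrite E in Hu; contradiction. }
  assert (Hes : e \in s).
  { apply NNPP; intros N. apply (all_eq o ho); intros u Hu.
    destruct (proj1 (mem_zero u) (Hsub u Hu)) as [E|E]; [exact E|].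
    rewrite E in Hu; contradiction. }
  intros u; split; [apply Hsub|].
  rewrite mem_zero; intros [E|E]; now rewrite E.
Qed.

Lemma ordinal_mem b v : ordinal o e b -> v \in b -> v \notin v -> ordinal o e v.
Proof.
  intros [[Hb [Ht Hm]] [H0 Hi]] Hv Hvv; repeat split.
  - exact Hvv.
  - exact (Hm v Hv).
  - intros u Hu; exact (Hm u (Ht v Hv u Hu)).
  - intros H; exact (Hvv (zero_individual H)).
  - intros u [Hu Huu]; apply Hi; split; [exact (Ht v Hv u Hu)|exact Huu].
Qed.

(** By regularity, either [b] has only individual members, or some non-individual member [v] has,
    since [b] is transitive. By [eq_zero] that set is 0. *)
Lemma zero_subset_ordinal b : ordinal o e b -> subset (zero o e) b.
Proof.
  intros [[Hb [Ht _]] [_ Hi]].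
  destruct (ax_regularity b) as [v [[Hv [Hvv Hall]]|[Hv [Hvv Hmin]]]].
  - assert (E : b == zero o e).
    { apply eq_zero; [exact Hb|]. intros u Hu; apply Hi; auto. }
    intros u; now rewrite E.
  - assert (E : v == zero o e).
    { apply eq_zero; [exact Hvv|]. intros u Hu.
      pose proof (Ht v Hv u Hu) as Hub.
      apply Hi; split; [exact Hub|]. apply NNPP; intros N.
      exact (Hmin u (conj Hu N) Hub). }
    intros u; rewrite <- E; exact (Ht v Hv u).
Qed.

(** Regularity is applied to the set of non-individual counterexamples in [b], which separation
    provides once there is one. The parameters of [P] sit in [rho], so that its definability can be
    stated. *)
Lemma ordinal_induction b (P : (nat -> M) -> M -> Prop) (rho : nat -> M) :
  ordinal o e b ->
  definable (fun rho => P (fun i => rho (S i)) (rho 0)) ->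
  (forall v, ordinal o e v -> v \in b ->
     (forall w, w \in v -> w \notin w -> P rho w) -> P rho v) ->
  forall v, v \in b -> v \notin v -> P rho v.
Proof.
  intros Hb HP step v0 Hv0 Hvv0; apply NNPP; intros HN.
  assert (D : definable (fun rho =>
            rho 0 \notin rho 0 /\ ~ P (fun i => rho (S i)) (rho 0))).
  { apply definable_and; apply definable_not;
      [apply definable_var_mem|exact HP]. }
  destruct D as [phi Hphi].
  destruct (@ax_separation M phi rho b) as [s Hs].
  { exists v0; split; [exact Hv0|]. apply Hphi; now split. }
  assert (Hs' : forall u, u \in s <-> u \in b /\ u \notin u /\ ~ P rho u).
  { intros u; rewrite Hs, Hphi; reflexivity. }
  destruct (ax_regularity s) as [v [[Hv [Hvv Hall]]|[Hv [Hvv Hmin]]]].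
  - now apply Hs' in Hv.
  - apply Hs' in Hv. destruct Hv as [Hv [_ HNv]]. apply HNv.
    apply step; [now apply (ordinal_mem Hb)|exact Hv|].
    intros w Hw Hww; apply NNPP; intros HNw.
    apply (Hmin w (conj Hw Hww)). apply Hs'; repeat split; auto.
    destruct Hb as [[_ [Ht _]] _]; exact (Ht v Hv w Hw).
Qed.

Lemma ordinal_trans b u v : ordinal o e b -> u \in v -> v \in b -> u \in b.
Proof. intros [[_ [Ht _]] _] Hu Hv; exact (Ht v Hv u Hu). Qed.

(** All ordinals share the individual members [o] and [e]; this settles the members that
    [ordinal_induction] does not reach. *)
Lemma ordinal_individual_mem b u v :
  ordinal o e b -> ordinal o e v -> u \in b -> u \in u -> u \in v.
Proof.
  intros Hb Hv Hu Huu. apply (zero_subset_ordinal Hv).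
  destruct Hb as [_ [_ Hi]]; now apply Hi.
Qed.

Lemma ordinal_comparable b : ordinal o e b ->
  forall x, x \in b -> x \notin x -> forall y, y \in b -> y \notin y ->
  x \in y \/ x == y \/ y \in x.
Proof.
  intros Hb.
  (* Outer induction on [x], for all [y] at once; the parameter at index 0 is [b]. The inner
     induction on [y] has the parameter [x] instead. *)
  apply (@ordinal_induction b
    (fun rho x => forall y, y \in rho 0 -> y \notin y ->
       x \in y \/ x == y \/ y \in x) (fun _ => b) Hb).
  { definability. }
  intros x Hx Hxb IHx.
  apply (@ordinal_induction b
    (fun rho y => rho 0 \in y \/ rho 0 == y \/ y \in rho 0) (fun _ => x) Hb).
  { definability. }
  intros y Hy Hyb IHy.
  (* If neither set belongs to the other, the induction hypotheses put each member of one into the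
     other, so they are coextensional. *)
  apply NNPP; intros N. apply N; right; left. intros u; split; intros Hu.
  - destruct (classic (u \in u)) as [Huu|Huu];
      [exact (ordinal_individual_mem Hx Hy Hu Huu)|].
    destruct (IHx u Hu Huu y Hyb (proj1 (proj1 Hy))) as [H|[H|H]].
    + exact H.
    + exfalso; apply N; right; right. now rewrite <- H.
    + exfalso; apply N; right; right. exact (ordinal_trans Hx H Hu).
  - destruct (classic (u \in u)) as [Huu|Huu];
      [exact (ordinal_individual_mem Hy Hx Hu Huu)|].
    destruct (IHy u Hu Huu) as [H|[H|H]].
    + exfalso; apply N; left. exact (ordinal_trans Hy H Hu).
    + exfalso; apply N; left. now rewrite H.
    + exact H.
Qed.

(** A member [d] outside [bigcup b] belongs to no member of [b], itself included; by comparability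
    every other non-individual member of [b] then lies in [d]. *)
Lemma ordinal_limit_or_succ b : ordinal o e b ->
  bigcup b == b \/ exists d, d \in b /\ d \notin d /\ b == succ d.
Proof.
  intros Hb. destruct (classic (exists d, d \in b /\ d \notin bigcup b))
    as [[d [Hd HN]]|HN].
  - right; exists d.
    assert (Hdd : d \notin d).
    { intros H; apply HN, bigcupP; now exists d. }
    repeat split; trivial; rewrite succP.
    + intros Hu. destruct (classic (u \in u)) as [Huu|Huu].
      * left; exact (ordinal_individual_mem Hb (ordinal_mem Hb Hd Hdd) Hu Huu).
      * destruct (ordinal_comparable Hb Hu Huu Hd Hdd) as [H|[H|H]]; auto.
        exfalso; apply HN, bigcupP; now exists u.
    + intros [Hu|Hu]; [exact (ordinal_trans Hb Hu Hd)|now rewrite Hu].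
  - left; intros u; split.
    + rewrite bigcupP; intros [w [Hw Hu]]; exact (ordinal_trans Hb Hu Hw).
    + intros Hu; apply NNPP; intros N; apply HN; now exists u.
Qed.

(** * Natural numbers and the recursion for addition *)

Lemma zero_natural : natural o e (zero o e).
Proof.
  (* An individual equals each of its members, so 0 being one would identify [o] and [e]. *)
  assert (N : zero o e \notin zero o e).
  { intros H.
    assert (Ho : o \in zero o e) by (apply mem_zero; now left).
    assert (He : e \in zero o e) by (apply mem_zero; now right).
    pose proof (ax_individuals H Ho) as E1.
    pose proof (ax_individuals H He) as E2.
    apply hoe; rewrite E1; now symmetry. }
  assert (T : forall u, u \in zero o e -> transitive u).
  { intros u Hu v Hv w Hw. pose proof (zero_individual Hu) as Huu.
    now rewrite <- (ax_individuals Huu Hv). }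
  repeat split; trivial.
  - intros u Hu v Hv. now rewrite (ax_individuals (zero_individual Hu) Hv).
  - intros u Hu; now left.
Qed.

Lemma succ_natural n : natural o e n -> natural o e (succ n).
Proof.
  intros [[Hn [Ht Hm]] [H0 Hb]].
  pose proof (succ_not_individual Ht Hn) as N.
  repeat split.
  - exact N.
  - intros u Hu v Hv; apply succP; left; apply succP in Hu; destruct Hu as [Hu|Hu].
    + exact (Ht u Hu v Hv).
    + now rewrite <- Hu.
  - intros u Hu; apply succP in Hu; destruct Hu as [Hu|Hu]; [exact (Hm u Hu)|].
    intros v Hv w Hw; rewrite Hu in Hv |- *; exact (Ht v Hv w Hw).
  - intros H; exact (N (zero_individual H)).
  (* [succ n] unfolds to [cup n (sing n)], so [Hb] covers its members; only [succ n] itself is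
     new. *)
  - intros u Hu; apply cupP in Hu; destruct Hu as [Hu|Hu]; [exact (Hb u Hu)|].
    right; apply singP in Hu. rewrite Hu, (bigcup_succ Ht). apply mem_succ.
Qed.

Lemma is_plus_zero b : is_plus o e b (zero o e) b.
Proof.
  exists (sing (opair (zero o e) b)).
  assert (H : opair (zero o e) b \in sing (opair (zero o e) b)) by now apply singP.
  repeat split; trivial.
  - intros p Hp; apply singP in Hp. exists (zero o e), b.
    split; [apply zero_natural|split; [apply mem_succ|exact Hp]].
  (* A natural number is not in 0, so the only one in [succ 0] is 0 itself. *)
  - intros k Hk Hk'; apply succP in Hk'. destruct Hk as [_ [Hk _]].
    destruct Hk' as [Hk'|Hk']; [contradiction|].
    exists b; split; [now rewrite Hk'|].
    intros y Hy; apply singP, opair_inj in Hy; apply Hy.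
  - intros k x [_ [Hk _]] Hk'; contradiction.
Qed.

(** The added pair does not clash with [f]: first components in [f] lie in [succ n], and [succ n]
    does not. *)
Lemma is_plus_succ a n d b :
  natural o e n -> is_plus o e a n d -> b == succ d -> is_plus o e a (succ n) b.
Proof.
  intros Hn [f [[Hdom [Hfun [H0 Hstep]]] Hnd]] Eb.
  pose proof (succ_natural Hn) as HSn.
  assert (HN : succ n \notin succ n) by apply HSn.
  set (f' := cup f (sing (opair (succ n) b))).
  assert (f'P : forall p, p \in f' <-> p \in f \/ p == opair (succ n) b).
  { intros p; unfold f'; now rewrite cupP, singP. }
  assert (Hdom' : forall k x, opair k x \in f -> k \in succ n).
  { intros k x H; destruct (Hdom _ H) as [k' [x' [_ [Hk' E]]]].
    apply opair_inj in E; now rewrite (proj1 E). }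
  exists f'; split; [repeat split|].
  - intros p Hp; apply f'P in Hp; destruct Hp as [Hp|Hp].
    + destruct (Hdom p Hp) as [k [x [Hk [Hk' E]]]]; exists k, x.
      split; [exact Hk|split; [apply succP; now left|exact E]].
    + exists (succ n), b. split; [exact HSn|split; [apply mem_succ|exact Hp]].
  - intros k Hk Hk'; apply succP in Hk'; destruct Hk' as [Hk'|Hk'].
    + destruct (Hfun k Hk Hk') as [x [Hx Hu]]; exists x; split.
      * apply f'P; now left.
      * intros y Hy; apply f'P in Hy; destruct Hy as [Hy|Hy]; [now apply Hu|].
        apply opair_inj in Hy; rewrite (proj1 Hy) in Hk'; contradiction.
    + exists b; split.
      * apply f'P; right; now rewrite Hk'.
      * intros y Hy; apply f'P in Hy; destruct Hy as [Hy|Hy].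
        -- apply Hdom' in Hy; rewrite Hk' in Hy; contradiction.
        -- now apply opair_inj in Hy.
  - apply f'P; now left.
  - intros k x Hk Hk' Hx; apply f'P in Hx; apply f'P; destruct Hx as [Hx|Hx].
    + apply succP in Hk'; destruct Hk' as [Hk'|Hk'].
      * left; now apply Hstep.
      (* Here [k == n]; uniqueness of the value at [n] gives [x == d], so the required pair is the
         added one. *)
      * right. destruct (Hfun n Hn (mem_succ n)) as [z [_ Hu]].
        rewrite Hk' in Hx. rewrite Hk', Eb, (Hu _ Hx), (Hu _ Hnd). reflexivity.
    + apply opair_inj in Hx; rewrite (proj1 Hx) in Hk'; contradiction.
  - apply f'P; now right.
Qed.

(** * Decomposition of an ordinal into a first number and a natural number *)

Lemma decomposition_step b : ordinal o e b ->
  (forall d, d \in b -> d \notin d -> exists a n,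
     ordinal o e a /\ natural o e n /\ bigcup a == a /\ is_plus o e a n d) ->
  exists a n,
    ordinal o e a /\ natural o e n /\ bigcup a == a /\ is_plus o e a n b.
Proof.
  intros Hb IH. destruct (ordinal_limit_or_succ Hb) as [H|[d [Hd [Hdd E]]]].
  - exists b, (zero o e).
    split; [exact Hb|split; [apply zero_natural|split; [exact H|]]].
    apply is_plus_zero.
  - destruct (IH d Hd Hdd) as [a [n [Ha [Hn [Hl Hp]]]]].
    exists a, (succ n).
    split; [exact Ha|split; [now apply succ_natural|split; [exact Hl|]]].
    exact (is_plus_succ Hn Hp E).
Qed.

End Ordinals.

Theorem theorem6 (M : model) (o e : M)
  (ho : individual o) (he : individual e) (hoe : ~ o == e)
  (beta : M) (hbeta : ordinal o e beta) :
  exists alpha n : M,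
    ordinal o e alpha /\ natural o e n /\
    bigcup alpha == alpha /\
    is_plus o e alpha n beta.
Proof.
  (* Induction only reaches the members of [beta], so the step is applied once more at [beta]
     itself. *)
  apply (decomposition_step ho he hoe hbeta).
  (* The parameters [o] and [e] take indices 0 and 1; the value at later indices is arbitrary. *)
  apply (ordinal_induction ho he (rho := scons o (scons e (fun _ => o)))
    (P := fun rho d => exists a n,
       ordinal (rho 0) (rho 1) a /\ natural (rho 0) (rho 1) n /\
       bigcup a == a /\ is_plus (rho 0) (rho 1) a n d) hbeta).
  { definability. }
  intros v Hv _ IH; exact (decomposition_step ho he hoe Hv IH).
Qed.
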